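(* If $\mathcal{O}(\overline{0})$ is closed, then for every $\tau\in\{1,\dots,N\}$ the probabilistic occupancy function $\overline{y}\mapsto\phi_{\boldsymbol{x}}(\overline{y};\tau)$ is upper semicontinuous on $\mathbb{R}^n$, and the set $\mathrm{PrOccupySet}_P(\alpha;\tau)=\{\overline{y}\in\mathbb{R}^n:\phi_{\boldsymbol{x}}(\overline{y};\tau)\ge\alpha\}$ is closed for every $\alpha\in\mathbb{R}$.
   Context: DPV system (discrete-time affine parameter-varying stochastic system). Fix $N,n,m,p,l\ge 1$, a finite set $\mathcal{P}\subset\mathbb{R}^l$ and maps $A:\mathcal{P}\to\mathbb{R}^{n\times n}$, $B:\mathcal{P}\to\mathbb{R}^{n\times m}$, $F:\mathcal{P}\to\mathbb{R}^{n\times p}$. For $t=0,\dots,N-1$, $$\boldsymbol{x}_{t+1}=A(\overline\lambda_t)\boldsymbol{x}_t+B(\overline\lambda_t)\overline{u}_t+F(\overline\lambda_t)\boldsymbol{w}_t,$$ where $\boldsymbol{x}_0=\overline{x}_0\in\mathbb{R}^n$, the parameters $\overline\lambda_t\in\mathcal{P}$ and the inputs $\overline{u}_t\in\mathbb{R}^m$ are known and deterministic, and $\boldsymbol{w}_0,\dots,\boldsymbol{w}_{N-1}$ are IID random vectors in $\mathbb{R}^p$ with a density. Obstacle: let $h_{\mathrm{obs}}:\mathbb{R}^n\to\mathbb{R}$ be Borel and $\mathcal{O}(\overline{c})=\{\overline{z}\in\mathbb{R}^n:h_{\mathrm{obs}}(\overline{z}-\overline{c})\ge0\}$ for $\overline{c}\in\mathbb{R}^n$;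 the shape $\mathcal{O}(\overline{0})$ is a Borel set of non-zero Lebesgue measure. The probabilistic occupancy function is $$\phi_{\boldsymbol{x}}(\overline{y};\tau)=\mathbb{P}\{\boldsymbol{x}_\tau\in\{\overline{z}\in\mathbb{R}^n:\overline{y}\in\mathcal{O}(\overline{z})\}\}.$$ *)

(* Defs.v *)
(* MathComp-Analysis *)
From HB Require Import structures.
From mathcomp Require Import all_boot all_order all_algebra finmap.
From mathcomp Require Import all_classical all_reals all_analysis.

Set Implicit Arguments.
Unset Strict Implicit.
Unset Printing Implicit Defensive.

Import Order.TTheory GRing.Theory Num.Theory.
Import numFieldNormedType.Exports.

Local Open Scope classical_set_scope.
Local Open Scope ring_scope.

Notation borel V := (g_sigma_algebraType (@open V)).

Section lebesgue_vector.
Context {R : realType}.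
Local Open Scope ereal_scope.

Definition cons_pair n (vx : n.-tuple R * R) : n.+1.-tuple R :=
  [tuple of vx.2 :: vx.1].

Lemma measurable_cons_pair n : measurable_fun setT (@cons_pair n).
Proof. exact: measurable_cons. Qed.

Section step.
Variables (n : nat) (mu : {measure set (n.-tuple R) -> \bar R}).

(* lebesgue_measure is the right factor because \x requires sigma-finiteness
   of its second argument only. *)
Definition lebesgue_cons : set (n.+1.-tuple R) -> \bar R :=
  pushforward (mu \x @lebesgue_measure R) (@cons_pair n).

Let lebesgue_cons0 : lebesgue_cons set0 = 0.
Proof. by rewrite /lebesgue_cons/pushforward preimage_set0 measure0. Qed.

Let lebesgue_cons_ge0 A : 0 <= lebesgue_cons A.
Proof. by rewrite /lebesgue_cons/pushforward measure_ge0. Qed.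

Let lebesgue_cons_sigma_additive : semi_sigma_additive lebesgue_cons.
Proof. apply: measure_semi_sigma_additive; exact: measurable_cons_pair. Qed.

HB.instance Definition _ := isMeasure.Build _ _ _ lebesgue_cons
  lebesgue_cons0 lebesgue_cons_ge0 lebesgue_cons_sigma_additive.

End step.

Fixpoint lebesgue_tuple n : {measure set (n.-tuple R) -> \bar R} :=
  if n is k.+1 then lebesgue_cons (lebesgue_tuple k) else \d_[tuple].

Definition col_tuple n (v : n.-tuple R) : 'cV[R]_n := \col_i tnth v i.

Lemma measurable_col_tuple n :
  measurable_fun setT (@col_tuple n : n.-tuple R -> borel 'cV[R]_n).
Proof.
apply: (@measurability _ _ _ (borel 'cV[R]_n) setT _ (@open 'cV[R]_n)) => //.
move=> _ [U oU <-]; rewrite setTI.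
pose B (cq : 'cV[rat]_n * rat) :=
  ball (map_mx ratr cq.1 : 'cV[R]_n) (ratr cq.2 : R).
have mB cq : measurable (@col_tuple n @^-1` B cq).
  have [q0|q0] := ltP 0%R (ratr cq.2 : R); last first.
    rewrite (_ : _ @^-1` _ = set0)// -subset0 => v [/= q1 _].
    by move: (lt_le_trans q1 q0); rewrite ltxx.
  rewrite (_ : _ @^-1` _ = \bigcap_(i in [set: 'I_n])
      (fun v : n.-tuple R => tnth v i) @^-1` ball (ratr (cq.1 i ord0) : R) (ratr cq.2 : R)).
    apply: fin_bigcap_measurable => // i _; rewrite -[X in measurable X]setTI.
    by apply: measurable_tnth => //; exact: measurable_realfun.measurable_ball.
  apply/seteqP; split => [v [_ vB] i _|v vB] /=.
    by have := vB i ord0; rewrite !mxE.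
  by split=> // i j; rewrite ord1 !mxE; exact: vB.
rewrite (_ : _ @^-1` U = \bigcup_(cq in [set cq | B cq `<=` U])
    (@col_tuple n @^-1` B cq)).
  rewrite bigcup_mkcond; apply: countable_bigcupT_measurable => // cq.
  by case: ifP.
apply/seteqP; split => [v Uv|v [cq /= + Bv]]; last exact.
have /nbhs_ballP[e e0 eU] : nbhs (col_tuple v) U by exact: open_nbhs_nbhs.
have [q] : exists q, ratr q \in `]0%R, (e / 2)%R[.
  by apply: rat_in_itvoo; rewrite divr_gt0.
rewrite in_itv/= => /andP[q0 qe].
have /all_sig[c cq] (i : 'I_n) : {c : rat | ball (tnth v i) (ratr q) (ratr c : R)}.
  apply: cid; have [c] : exists c, ratr c \in
      `](tnth v i - ratr q)%R, (tnth v i + ratr q)%R[.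
    by apply: rat_in_itvoo; rewrite ltrD2l gtrN.
  by rewrite in_itv/= => cq; exists c; rewrite ball_itv/= in_itv.
have cB : ball (map_mx ratr (\col_i c i) : 'cV[R]_n) (ratr q : R) (col_tuple v).
  by split=> // i j; rewrite !mxE; apply: ball_sym; exact: cq.
exists (\col_i c i, q) => //= w Bw; apply: eU.
apply: (@le_ball _ _ _ (ratr q + ratr q)).
  by rewrite [leRHS]splitr lerD// ltW.
by apply: ball_triangle Bw; exact: ball_sym.
Qed.

Section lebesgue_col.
Variable n : nat.

Definition lebesgue_col : set (borel 'cV[R]_n) -> \bar R :=
  pushforward (lebesgue_tuple n) (@col_tuple n : _ -> borel 'cV[R]_n).

Let lebesgue_col0 : lebesgue_col set0 = 0.
Proof. by rewrite /lebesgue_col/pushforward preimage_set0 measure0. Qed.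

Let lebesgue_col_ge0 A : 0 <= lebesgue_col A.
Proof. by rewrite /lebesgue_col/pushforward measure_ge0. Qed.

Let lebesgue_col_sigma_additive : semi_sigma_additive lebesgue_col.
Proof. apply: measure_semi_sigma_additive; exact: measurable_col_tuple. Qed.

HB.instance Definition _ := isMeasure.Build _ _ _ lebesgue_col
  lebesgue_col0 lebesgue_col_ge0 lebesgue_col_sigma_additive.

End lebesgue_col.

(* This pins lebesgue_col down as the Lebesgue measure of R^n. *)
Lemma lebesgue_col_box n (I : 'I_n -> interval R) :
  lebesgue_col [set v : 'cV[R]_n | forall i, v i ord0 \in I i] =
  \prod_(i < n) lebesgue_measure [set` I i].
Proof.
rewrite /lebesgue_col /pushforward /=.
rewrite (_ : _ @^-1` _ = [set v : n.-tuple R | forall i, tnth v i \in I i]); last first.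
  by apply/seteqP; split => v /= vI i; have := vI i; rewrite mxE.
elim: n I => [|n ih] I /=.
  by rewrite big_ord0 /dirac/= indicE mem_set// => -[].
rewrite /lebesgue_cons /pushforward big_ord_recl/=.
rewrite (_ : _ @^-1` _ =
    [set v : n.-tuple R | forall i, tnth v i \in I (lift ord0 i)] `*` [set` I ord0]).
  rewrite product_measure1E//; first by rewrite ih muleC.
  rewrite (_ : mkset _ = \bigcap_(i in [set: 'I_n])
      (fun v : n.-tuple R => tnth v i) @^-1` [set` I (lift ord0 i)]).
    apply: fin_bigcap_measurable => // i _; rewrite -[X in measurable X]setTI.
    by apply: measurable_tnth => //; exact: measurable_itv.
  by apply/seteqP; split => [v vI i _|v vI i] /=; exact: vI.
apply/seteqP; split => [[v x] /= vI|[v x] /= [vI xI] i].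
  split=> [i|]; last exact: (vI ord0).
  by have := vI (lift ord0 i); rewrite tnthS.
by case: (unliftP ord0 i) => [j|] ->; [rewrite tnthS; exact: vI|].
Qed.

End lebesgue_vector.
Arguments lebesgue_col {R n} _.

Section probability_notions.
Local Open Scope ereal_scope.
Context d (T : measurableType d) (R : realType) (P : probability T R).
Context d' (E : measurableType d') (N : nat) (w : 'I_N -> {RV P >-> E}).

Definition mutually_independent :=
  forall (J : {set 'I_N}) (B : 'I_N -> set E), (forall t, measurable (B t)) ->
    P (\bigcap_(t in [set` J]) w t @^-1` B t) =
    \prod_(t in J) P (w t @^-1` B t).

Definition identically_distributed :=
  forall (s t : 'I_N) (B : set E), measurable B ->
    distribution P (w s) B = distribution P (w t) B.

Definition iid := mutually_independent /\ identically_distributed.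

End probability_notions.

Definition has_density d (T : measurableType d) (R : realType)
    (P : probability T R) p (X : {RV P >-> borel 'cV[R]_p}) :=
  exists f : borel 'cV[R]_p -> R,
    [/\ measurable_fun setT f, (forall v, 0 <= f v) &
      forall B : set (borel 'cV[R]_p), measurable B ->
        (distribution P X B = \int[lebesgue_col]_(v in B) (f v)%:E)%E].

(* Dual of the library's lower_semicontinuous. *)
Definition upper_semicontinuous (V : topologicalType) (R : numFieldType)
    (f : V -> \bar R) :=
  forall x a, (f x < a%:E)%E ->
    exists2 U, nbhs x U & forall y, U y -> (f y < a%:E)%E.

Section dpv_system.
Context {R : realType}.

(* Only x 0, ..., x N are constrained. *)
Definition dpv_solution N n m p l (params : {fset 'cV[R]_l})
    (A : params -> 'M[R]_n) (B : params -> 'M[R]_(n, m))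
    (F : params -> 'M[R]_(n, p)) (x0 : 'cV[R]_n) (lam : 'I_N -> params)
    (u : 'I_N -> 'cV[R]_m) (T : Type) (w : 'I_N -> T -> 'cV[R]_p)
    (x : nat -> T -> 'cV[R]_n) :=
  (forall om, x 0%N om = x0) /\
  forall (t : 'I_N) om,
    x t.+1 om = A (lam t) *m x t om + B (lam t) *m u t + F (lam t) *m w t om.

Definition obstacle n (h : 'cV[R]_n -> R) (c : 'cV[R]_n) : set 'cV[R]_n :=
  [set z | 0 <= h (z - c)].

Context d (T : measurableType d) (P : probability T R).
Context n (h : 'cV[R]_n -> R) (x : nat -> T -> 'cV[R]_n).

Definition occupancy (tau : nat) (y : 'cV[R]_n) : \bar R :=
  P (x tau @^-1` [set z | obstacle h z y]).

Definition PrOccupySet (alpha : R) (tau : nat) : set 'cV[R]_n :=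
  [set y | (alpha%:E <= occupancy tau y)%E].

End dpv_system.

(* Main.v *)
(** The state [x tau] is a random vector, and the occupancy function at [y] is
    the probability that [y - x tau] lies in the closed shape [C]. Let [G k] be
    the event that [y - x tau] is within [1 / (k + 1)] of [C]: these events
    decrease to [y - x tau \in C] because [C] is closed, so [P (G k)] falls below
    any bound above the occupancy at [y]; and [G k] contains the event
    [z - x tau \in C] for every [z] within [1 / (k + 1)] of [y]. *)
Require Import Defs.
From mathcomp Require Import all_boot all_order all_algebra finmap.
From mathcomp Require Import all_classical all_reals all_analysis.
From mathcomp Require Import measurable_realfun.
Import Order.TTheory GRing.Theory Num.Theory.
Import numFieldNormedType.Exports.
Local Open Scope classical_set_scope.
Local Open Scope ring_scope.

Lemma measurable_coord (R : realType) (n : nat) (i : 'I_n) :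
  measurable_fun setT ((fun v => v i ord0) : borel 'cV[R]_n -> R).
Proof.
apply: (measurability _ (RGenOInfty.measurableE R)) => _ [_ [a ->] <-].
rewrite setTI; apply: sub_sigma_algebra.
apply: open_comp; last exact: interval_open.
by move=> v _; exact: coord_continuous.
Qed.

(** Tuples carry the product sigma-algebra, where measurability is checked coordinate by coordinate;
    [f] factors through the tuple of its coordinates, and [col_tuple] passes from there to the Borel
    sets of columns. *)
Lemma measurable_fun_col (R : realType) (d : measure_display)
    (T : measurableType d) (n : nat) (f : T -> 'cV[R]_n) :
  (forall i, measurable_fun setT (fun om => f om i ord0)) ->
  measurable_fun setT (f : T -> borel 'cV[R]_n).
Proof.
move=> mf; pose g om := [tuple f om i ord0 | i < n].
have -> : f = @col_tuple R n \o g.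
  by apply/funext => om; apply/colP => i; rewrite mxE tnth_mktuple.
apply: measurableT_comp; first exact: measurable_col_tuple.
apply/measurable_fun_tnthP => i; rewrite (_ : _ \o _ = fun om => f om i ord0)//.
by apply/funext => om /=; rewrite tnth_mktuple.
Qed.

Lemma measurable_fun_mulmx (R : realType) (d : measure_display)
    (T : measurableType d) (n p : nat) (M : 'M[R]_(n, p)) (f : T -> 'cV[R]_p) :
  measurable_fun setT (f : T -> borel 'cV[R]_p) ->
  measurable_fun setT ((fun om => M *m f om) : T -> borel 'cV[R]_n).
Proof.
move=> mf; apply: measurable_fun_col => i.
under eq_fun do rewrite mxE.
apply: measurable_sum => j; apply: measurable_funM => //.
exact: (measurableT_comp (measurable_coord R p j) mf).
Qed.

Lemma measurable_fun_addmx (R : realType) (d : measure_display)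
    (T : measurableType d) (n : nat) (f g : T -> 'cV[R]_n) :
  measurable_fun setT (f : T -> borel 'cV[R]_n) ->
  measurable_fun setT (g : T -> borel 'cV[R]_n) ->
  measurable_fun setT ((fun om => f om + g om) : T -> borel 'cV[R]_n).
Proof.
move=> mf mg; apply: measurable_fun_col => i.
under eq_fun do rewrite mxE.
apply: measurable_funD.
  exact: (measurableT_comp (measurable_coord R n i) mf).
exact: (measurableT_comp (measurable_coord R n i) mg).
Qed.

(** Matrix products and sums preserve measurability, so it propagates along the recursion from the
    constant initial state. The bound on [t] reflects that [dpv_solution] leaves [x] arbitrary
    beyond [N]. *)
Lemma dpv_solution_measurable (R : realType) (d : measure_display)
    (T : measurableType d) (N n m p l : nat) (params : {fset 'cV[R]_l})
    (A : params -> 'M[R]_n) (B : params -> 'M[R]_(n, m))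
    (F : params -> 'M[R]_(n, p)) (x0 : 'cV[R]_n) (lam : 'I_N -> params)
    (u : 'I_N -> 'cV[R]_m) (w : 'I_N -> T -> 'cV[R]_p)
    (x : nat -> T -> 'cV[R]_n) :
  (forall t, measurable_fun setT (w t : T -> borel 'cV[R]_p)) ->
  dpv_solution A B F x0 lam u w x ->
  forall t, (t <= N)%N -> measurable_fun setT (x t : T -> borel 'cV[R]_n).
Proof.
move=> mw [x_0 x_S]; elim=> [_|t IHt tN].
  by rewrite (_ : x 0%N = cst x0)//; apply/funext => om; rewrite x_0.
(* [tN] reads both as [t.+1 <= N] and as [t < N], hence makes [t] a valid noise index. *)
rewrite (_ : x t.+1 = fun om => A (lam (Ordinal tN)) *m x t om +
    B (lam (Ordinal tN)) *m u (Ordinal tN) +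
    F (lam (Ordinal tN)) *m w (Ordinal tN) om).
  apply: measurable_fun_addmx; last exact: measurable_fun_mulmx.
  apply: measurable_fun_addmx => //.
  by apply: measurable_fun_mulmx; apply: IHt; exact: ltnW.
by apply/funext => om; exact: x_S (Ordinal tN) om.
Qed.

Lemma upper_semicontinuous_translate (R : realType) (d : measure_display)
    (T : measurableType d) (P : probability T R) (V : normedModType R)
    (X : T -> V) (C : set V) :
  measurable_fun setT (X : T -> borel V) -> closed C ->
  upper_semicontinuous (fun y => P [set om | C (y - X om)]).
Proof.
move=> mX cC y a ya.
have mC z : measurable [set om | C (z - X om)].
  rewrite -[X in measurable X]setTI.
  apply: (mX _ ((fun v => z - v) @^-1` C)) => //.
  rewrite -[X in measurable X]setCK; apply: measurableC.
  apply: sub_sigma_algebra; apply: closed_openC; apply: closed_comp => // v _.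
  by apply: continuousB; [exact: cst_continuous|exact: id].
(* Being within the radius of [c] is moved from [y - X om] to [X om] by centering the ball at
   [y - c]; a union of balls is open, so each [G k] is an event. *)
pose G k : set T := X @^-1` \bigcup_(c in C) ball (y - c) k.+1%:R^-1.
have mG k : measurable (G k).
  rewrite -[G k]setTI; apply: mX => //; apply: sub_sigma_algebra.
  by apply: bigcup_open => c _; exact: ball_open.
have GE : \bigcap_k G k = [set om | C (y - X om)].
  apply/seteqP; split=> [om Gom|om Com k _] /=; last first.
    by exists (y - X om) => //; rewrite subKr; exact: ballxx.
  (* Closedness is used as adherence: every neighbourhood of [y - X om] must meet [C], and the point
     [c] provided by [G k] lies in it once [k] is large. *)
  apply: cC => U /nbhs_ballP[e /= e0 eU].
  near \oo => k.
  have [c Cc Xc] := Gom k I.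
  exists c; split=> //; apply: eU.
  apply: (@le_ball _ _ _ k.+1%:R^-1).
    by apply: ltW; near: k; exact: (near_infty_natSinv_lt (PosNum e0)).
  by move: Xc; rewrite -!ball_normE /= addrAC.
have : (P \o G) k @[k --> \oo] --> P [set om | C (y - X om)].
  rewrite -GE; apply: nonincreasing_cvg_mu => //.
  (* Continuity from above needs one event of finite measure. *)
  - exact: le_lt_trans (probability_le1 P (mG 0%N)) (ltry _).
  - by rewrite GE.
  move=> j k jk; apply/subsetPset => om [c Cc Xc]; exists c => //.
  by apply: le_ball Xc; rewrite lef_pV2 ?posrE// ler_nat.
move=> /(_ _ (open_ereal_lt' ya))[k _ /(_ k (leqnn k)) /= Gka].
exists (ball y k.+1%:R^-1); first exact: nbhsx_ballx.
move=> z yz; apply: le_lt_trans Gka.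
apply: le_measure; rewrite ?inE//.
(* With [c = z - X om], the difference [y - c - X om] is [y - z], so the radius that bounds [y - z]
   works for every [om]. *)
move=> om Com; exists (z - X om) => //.
by move: yz; rewrite -!ball_normE /= opprB addrAC addrA subrK.
Unshelve. all: by end_near. Qed.


Theorem proposition4 (R : realType) (d : measure_display)
    (T : measurableType d) (P : probability T R) (N n m p l : nat)
    (N_gt0 : (0 < N)%N) (n_gt0 : (0 < n)%N) (m_gt0 : (0 < m)%N)
    (p_gt0 : (0 < p)%N) (l_gt0 : (0 < l)%N)
    (params : {fset 'cV[R]_l}) (A : params -> 'M[R]_n)
    (B : params -> 'M[R]_(n, m)) (F : params -> 'M[R]_(n, p))
    (x0 : 'cV[R]_n) (lam : 'I_N -> params) (u : 'I_N -> 'cV[R]_m)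
    (w : 'I_N -> {RV P >-> borel 'cV[R]_p})
    (w_iid : iid w) (w_density : forall t, has_density (w t))
    (x : nat -> T -> 'cV[R]_n)
    (x_dpv : dpv_solution A B F x0 lam u (fun t => w t : T -> 'cV[R]_p) x)
    (h_obs : 'cV[R]_n -> R)
    (h_borel : measurable_fun setT (h_obs : borel 'cV[R]_n -> R))
    (shape_borel : measurable (obstacle h_obs 0 : set (borel 'cV[R]_n)))
    (shape_neq0 : lebesgue_col (obstacle h_obs 0) <> 0%E)
    (shape_closed : closed (obstacle h_obs 0)) :
  forall tau : nat, (1 <= tau <= N)%N ->
    upper_semicontinuous (occupancy P h_obs x tau) /\
    forall alpha : R, closed (PrOccupySet P h_obs x alpha tau).
Proof.
move=> tau /andP[_ tauN].
have mx : measurable_fun setT (x tau : T -> borel 'cV[R]_n).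
  by apply: dpv_solution_measurable x_dpv tau tauN => t; exact: measurable_funPT.
have usc : upper_semicontinuous (occupancy P h_obs x tau).
  (* An obstacle centred at the state contains [y] exactly when [y] minus the state lies in the
     shape at the origin. *)
  rewrite (_ : occupancy _ _ _ _ =
      fun y => P [set om | obstacle h_obs 0 (y - x tau om)]).
    exact: upper_semicontinuous_translate.
  by apply/funext => y; congr (P _); apply/seteqP; split=> om /=;
    rewrite /obstacle /= subr0.
(* The complement of the superlevel set is a strict sublevel set, which semicontinuity makes a
   neighbourhood of each of its points. *)
split=> // alpha; rewrite -openC openE => y /= /negP.
rewrite -ltNge => /usc[U yU Ua]; apply: filterS yU => z /Ua.
by rewrite ltNge => /negP.
Qed.
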